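(* Let $\alpha_{b,\rho,\Delta}>0$ be the constant (independent of $n$) from the generalized KKL theorem for $\Sigma=\{\pm1\}$, that is, the constant, depending only on $b,\rho,\Delta$, such that for every $n\ge1$, every probability measure $\nu$ on $\{\pm1\}^n$ satisfying conditions (1)-(3) below, and every $g:\{\pm1\}^n\to\{0,1\}$, there exists a coordinate $k\in[n]$ with $I_k(g)\ge\alpha_{b,\rho,\Delta}\,\mathrm{Var}_\nu(g)\log(n)/n$. For any $n\ge1$ and any probability measure $\nu$ on $\{\pm1\}^n$ satisfying: (1) there is a constant $b\ge1$ with $\nu(x)/\nu(y)\in[1/b,b]$ for all $x,y\in\{\pm1\}^n$ at Hamming distance one; (2) the Glauber dynamics for $\nu$ satisfy the log-Sobolev inequality with constant $\rho\in(0,1]$; (3) $\nu$ is a Markov random field with respect to a graph $G$ on $[n]$ of maximum degree $\Delta$; the following is true. For any $\epsilon>0$ and any monotone function $f:\{\pm1\}^n\to\{0,1\}$ satisfying $\mathbb{E}_\nu[f]\ge\epsilon$, there exists a set of coordinates $S\subset[n]$ such that $$\mathbb{E}_{X\sim\nu}[f(X_{\sim S},X_S\to1)]\ge1-\epsilon$$ and $$|S|\le\frac{4(1+b)\log(1/(2\epsilon))}{\alpha_{b,\rho,\Delta}}\cdot\frac{n}{\log(n)}.$$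
   Context: $\mathbb{E}_{X\sim\nu}[f(X_{\sim S},X_S\to1)]$ denotes the expectation of $f(Y)$ where $X\sim\nu$, $Y_i=1$ for $i\in S$ and $Y_i=X_i$ for $i\notin S$. A function $f$ on $\{\pm1\}^n$ is monotone if $f(x)\le f(y)$ whenever $x\le y$ coordinatewise. The influence of coordinate $i\in[n]=\{1,\dots,n\}$ on $g:\{\pm1\}^n\to\{0,1\}$ is $I_i(g)=\Pr_{X\sim\nu}[\exists x_i'\in\{\pm1\}:\ g(X)\ne g(X_1,\dots,X_{i-1},x_i',X_{i+1},\dots,X_n)]$. For a vector $x$, $x_{\sim i}$ denotes $x$ with coordinate $i$ removed; $(P_if)(x)=\mathbb{E}_{X\sim\nu}[f(X)\mid X_{\sim i}=x_{\sim i}]$ and $L_if=P_if-f$. The Dirichlet form of the (continuous-time) Glauber dynamics is $\mathcal{E}_\nu(f,f)=\sum_{i=1}^n\mathbb{E}_\nu[(L_if)^2]$. The Glauber dynamics for $\nu$ satisfy the log-Sobolev inequality with constant $\rho>0$ if $\rho\,\mathrm{Ent}_\nu[f]\le 2\mathcal{E}_\nu(\sqrt f,\sqrt f)$ for all $f:\{\pm1\}^n\to\mathbb{R}_{\ge0}$, where $\mathrm{Ent}_\nu[f]=\mathbb{E}_\nu[f\log f]-\mathbb{E}_\nu[f]\log\mathbb{E}_\nu[f]$. $\nu$ is a Markov random field with respect to $G$ if for every vertex $i$ with neighbor set $\mathcal{N}(i)$ in $G$ and $X\sim\nu$, $X_i$ is conditionally independent of $X_{\sim i}$ given $X_{\m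athcal{N}(i)}$.
   Formalization: The printed bound on |S| fails for ε near or above 1/2 (dictator, uniform measure); it is proved as printed for ε ≤ 1/32, and for every ε > 0 with its positive part rounded up to an integer; for n = 1 (log n = 0) no bound is claimed. *)

(* Defs.v *)
From mathcomp Require Import all_boot all_order all_algebra.
From mathcomp Require Import reals exp.

Set Implicit Arguments.
Unset Strict Implicit.
Unset Printing Implicit Defensive.

Import Order.TTheory GRing.Theory Num.Theory.
Local Open Scope ring_scope.

(* The cube {-1, 1}^n, with [true] encoding 1 and [false] encoding -1, so that
   the order false <= true of bool is the order -1 <= 1.  {0, 1}-valued
   functions on it are boolean functions, used as reals through (_)%:R. *)
Definition cube (n : nat) := {ffun 'I_n -> bool}.

Definition upd n (x : cube n) (i : 'I_n) (a : bool) : cube n :=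
  [ffun j => if j == i then a else x j].

(* (x_{~S}, x_S -> 1) *)
Definition set_to1 n (S : {set 'I_n}) (x : cube n) : cube n :=
  [ffun i => if i \in S then true else x i].

Definition hamming n (x y : cube n) : nat := #|[set i | x i != y i]|.

Definition monotone_fun n (f : cube n -> bool) : Prop :=
  forall x y : cube n, (forall i, (x i <= y i)%O) -> (f x <= f y)%O.

(* x and y have the same coordinates in A *)
Definition agree n (A : {set 'I_n}) (x y : cube n) : bool :=
  [forall i in A, x i == y i].

Section FiniteProbability.
Variables (R : realType) (n : nat).
Implicit Types (nu h : cube n -> R) (A B : pred (cube n)).

(* nu is the mass function of a probability measure *)
Definition is_prob nu : Prop := (forall x, 0 <= nu x) /\ \sum_x nu x = 1.

Definition Pr nu A : R := \sum_(x | A x) nu x.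

Definition Ex nu h : R := \sum_x nu x * h x.

Definition Var nu h : R := Ex nu (fun x => (h x - Ex nu h) ^+ 2).

(* These are 0 when Pr nu A = 0; condE below is only ever weighted by the mass
   of a point of A, and condPr is only used when the condition is not null. *)
Definition condPr nu A B : R := Pr nu (predI A B) / Pr nu B.

Definition condE nu h A : R := (\sum_(x | A x) nu x * h x) / Pr nu A.

Definition influence nu (g : cube n -> bool) (i : 'I_n) : R :=
  Pr nu (fun x => [exists a, g x != g (upd x i a)]).

Definition Pop nu (i : 'I_n) h (x : cube n) : R :=
  condE nu h (fun y => agree [set~ i] y x).

Definition Lop nu (i : 'I_n) h (x : cube n) : R := Pop nu i h x - h x.

Definition dirichlet nu h : R := \sum_i Ex nu (fun x => Lop nu i h x ^+ 2).

(* ln 0 = 0, so that the convention 0 log 0 = 0 holds *)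
Definition Ent nu h : R := Ex nu (fun x => h x * ln (h x)) - Ex nu h * ln (Ex nu h).

Definition bounded_ratio (b : R) nu : Prop :=
  forall x y : cube n, hamming x y = 1%N -> b^-1 <= nu x / nu y <= b.

Definition log_sobolev (rho : R) nu : Prop :=
  forall h, (forall x, 0 <= h x) ->
    rho * Ent nu h <= 2 * dirichlet nu (fun x => Num.sqrt (h x)).

Definition nbhd (e : rel 'I_n) (i : 'I_n) : {set 'I_n} := [set j | e i j].

Definition simple_graph (e : rel 'I_n) : Prop := symmetric e /\ irreflexive e.

Definition max_degree (e : rel 'I_n) : nat := \max_i #|nbhd e i|.

(* a, y and z are the values of X_i, X_{~i} and X_{N(i)} *)
Definition markov_field (e : rel 'I_n) nu : Prop :=
  forall (i : 'I_n) (a : bool) (y z : cube n),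
    let Xi := fun x : cube n => x i == a in
    let Xrest := fun x => agree [set~ i] x y in
    let XN := fun x => agree (nbhd e i) x z in
    0 < Pr nu XN ->
    condPr nu (predI Xi Xrest) XN = condPr nu Xi XN * condPr nu Xrest XN.

End FiniteProbability.

(* alpha has the property of the constant alpha_{b, rho, Delta} of the
   generalized KKL theorem: it works for all n and all measures at once. *)
Definition KKL_constant (R : realType) (b rho : R) (Delta : nat) (alpha : R) : Prop :=
  forall (n : nat) (nu : cube n -> R) (e : rel 'I_n) (g : cube n -> bool),
    (0 < n)%N ->
    is_prob nu ->
    bounded_ratio b nu ->
    log_sobolev rho nu ->
    simple_graph e -> max_degree e = Delta -> markov_field e nu ->
    exists k : 'I_n,
      influence nu g k >= alpha * Var nu (fun x => (g x)%:R) * ln n%:R / n%:R.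

Definition size_bound (R : realType) (b alpha eps : R) (n : nat) : R :=
  4 * (1 + b) * ln (1 / (2 * eps)) / alpha * (n%:R / ln n%:R).

(* Main.v *)
(* Adding coordinates greedily: if p is the mean of f with S set to 1 and
   p < 1 - eps, the KKL theorem gives an influential coordinate, and setting it
   to 1 raises the mean to at least p + c p (1 - p), where
   c = alpha ln n / (n (1 + b)): the influence of k on a monotone function is
   carried by pairs of points x, x' that differ at k, and the bounded ratio
   leaves at least 1 / (1 + b) of their mass on the point with value -1 at k.
   Applied to the indicator of a point of mass at most 1/4, the KKL theorem also
   gives c <= 4 / 3, so the steps are not too long for the discrete logistic
   growth to be controlled by potentials:
   - ln (2 p) for p < 1/2 and - ln (2 (1 - p)) beyond, which grows by c / 2 at
     each step and by exactly 2 ln (1 / (2 eps)) between eps and 1 - eps; this is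
     the bound of the theorem, rounded up;
   - 5 ln p - 3 ln (1 - p), which grows by 3 c at each step; for eps <= 1/32 this
     gains more than one step over the previous count, and the bound can be
     rounded down. *)
Require Import Defs.
From mathcomp Require Import all_boot all_order all_algebra.
From mathcomp Require Import boolp reals normedtype sequences derive realfun exp.
From mathcomp Require Import ring lra zify.

Import Order.TTheory GRing.Theory Num.Theory numFieldNormedType.Exports.
Local Open Scope ring_scope.

(** * Logarithmic potentials for discrete logistic growth *)

(* With y = c / 2 and p = 1/2 - d, this reads
   4 p (1 - p) (1 - c p) <= ((4 - y) / (4 + y)) ^ 2, and the right-hand side is a
   Pade lower bound for exp (- c / 2). *)
Lemma crossing_poly (R : realFieldType) (y d : R) : 0 <= y <= 2/3 -> 0 <= d ->
  (1 - 4 * d ^+ 2) * (1 - y + 2 * y * d) * (4 + y) ^+ 2 <= (4 - y) ^+ 2.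
Proof.
move=> /andP[y0 y1] d0.
have [->|yp] := eqVneq y 0; first by nra.
have {}yp : 0 < y by rewrite lt_def yp.
pose r := d / y.
have -> : d = y * r by rewrite /r mulrC divfK// gt_eqF.
have r0 : 0 <= r by rewrite divr_ge0.
(* The quadratic touches the cubic at r = 1/3, close to where the inequality is
   almost an equality for y = 2/3. *)
have hr : 2/3 * r ^+ 2 - r / 9 <= r ^+ 3.
  have : 0 <= r * (r - 1/3) ^+ 2 by rewrite mulr_ge0// sqr_ge0.
  nra.
(* The terms without [r] leave the difference [y^2 (8 + y)]; the factor [y^2] common to all that
   remains is divided out. *)
suff h : (2 * r - 4 * (1 - y) * r ^+ 2 - 8 * y ^+ 2 * r ^+ 3) * (4 + y) ^+ 2
    <= 8 + y.
  by have := ler_wpM2l (sqr_ge0 y) h; lra.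
have h1 : 2 * r - 4 * (1 - y) * r ^+ 2 - 8 * y ^+ 2 * r ^+ 3 <=
   (2 + 8/9 * y ^+ 2) * r - (4 - 4 * y + 16/3 * y ^+ 2) * r ^+ 2.
  by have := ler_wpM2l (sqr_ge0 y) hr; nra.
(* A quadratic [B r - a r^2] with [a > 0] is at most [B^2 / (4 a)], which leaves this inequality in
   [y] alone. *)
have h2 : (2 + 8/9 * y ^+ 2) ^+ 2 * (4 + y) ^+ 2
    <= 4 * (4 - 4 * y + 16/3 * y ^+ 2) * (8 + y).
  have y3 : y ^+ 3 <= 2/3 * y ^+ 2 by have := sqr_ge0 y; nra.
  have y4 : y ^+ 4 <= 4/9 * y ^+ 2 by have := ler_wpM2l y0 y3; lra.
  have y5 : y ^+ 5 <= 8/27 * y ^+ 2 by have := ler_wpM2l y0 y4; lra.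
  have y6 : y ^+ 6 <= 16/81 * y ^+ 2 by have := ler_wpM2l y0 y5; lra.
  nra.
set a := 4 - 4 * y + _ in h1 h2.
have a0 : 0 < a by rewrite /a; nra.
set B := 2 + _ in h1 h2.
have h3 : 4 * a * (B * r - a * r ^+ 2) <= B ^+ 2.
  by have := sqr_ge0 (2 * a * r - B); nra.
apply: le_trans (ler_wpM2r (sqr_ge0 _) h1) _.
rewrite -(ler_pM2l (_ : 0 < 4 * a)); last by rewrite mulr_gt0.
apply: le_trans h2; rewrite mulrA.
by apply: ler_wpM2r h3; rewrite sqr_ge0.
Qed.

(** The difference of the two sides vanishes at 0 and has derivative [1 - (1 - x) e^x], nonnegative
    since [1 - x <= e^(-x)]. *)
Lemma expR_le_pade (R : realType) (y : R) : 0 <= y -> (2 - y) * expR y <= 2 + y.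
Proof.
move=> y0.
pose f (x : R) : R := 2 + x - (2 - x) * expR x.
pose df (x : R) : R := 1 - (1 - x) * expR x.
have Df (x : R) : is_derive x 1 f (df x).
  by apply: is_derive_eq; rewrite /df /GRing.scale /=; ring.
have dfr (x : R) : derivable f x 1 by case: (Df x).
suff : f 0 <= f y by rewrite /f expR0; lra.
apply: (@ger0_derive1_ndecry R f 0) => // [x _|].
  rewrite derive1E; case: (Df x) => _ ->; rewrite /df.
  have := expR_ge1Dx (- x); have := expR_gt0 x; have := expRxMexpNx_1 x; nra.
apply: derivable_within_continuous => x _; exact: dfr.
Qed.

(** This is the Pade bound at [y = 2 x / (2 + x)], the value for which
    [(2 + y) / (2 - y) = 1 + x]. *)
Lemma ln1D_ge (R : realType) (x : R) : 0 <= x -> 2 * x / (2 + x) <= ln (1 + x).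
Proof.
move=> x0; have x2 : 0 < 2 + x by lra.
rewrite -[leLHS]expRK ler_ln ?posrE ?expR_gt0//; last by lra.
have y0 : 0 <= 2 * x / (2 + x) by rewrite divr_ge0//; lra.
have := @expR_le_pade R _ y0; set E := expR _ => h.
have k0 : 0 < 4 / (2 + x) by rewrite divr_gt0.
have e1 : 2 - 2 * x / (2 + x) = 4 / (2 + x) by field; lra.
have e2 : 2 + 2 * x / (2 + x) = 4 / (2 + x) * (1 + x) by field; lra.
by rewrite -(ler_pM2l k0) -e2 -e1.
Qed.

Lemma ln_2_ge (R : realType) : 2 / 3 <= ln (2 : R).
Proof.
by have := @ln1D_ge R 1 ler01; rewrite (_ : 2 * 1 / (2 + 1) = 2 / 3) //; field.
Qed.

Definition fold_log (R : realType) (p : R) : R :=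
  if p < 1 / 2 then ln (2 * p) else - ln (2 * (1 - p)).

Lemma ln_ub (R : realType) (x : R) : 0 < x -> ln x <= x - 1.
Proof.
by move=> x0; have := @le_ln1Dx R (x - 1); rewrite (addrC 1) subrK; apply; lra.
Qed.

Lemma fold_log_step (R : realType) (c p q : R) :
    0 < c <= 4 / 3 -> 0 < p < 1 -> q < 1 -> p + c * (p * (1 - p)) <= q ->
  fold_log R p + c / 2 <= fold_log R q.
Proof.
move=> /andP[c0 c1] /andP[p0 p1] q1 hpq.
have pq : p <= q.
  by apply: le_trans hpq; rewrite lerDl !mulr_ge0 ?subr_ge0 ?ltW.
have cp : c * p < 1.
  have : c * p * (1 - p) < 1 - p by lra.
  by rewrite -[ltRHS]mul1r ltr_pM2r//; lra.
rewrite /fold_log; case: (ltP p (1/2)) => hp; last first.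
  have -> : (q < 1/2) = false by apply/negbTE; rewrite -leNgt; lra.
  have : ln (2 * (1 - q)) <= ln (2 * (1 - p)) + ln (1 - c * p).
    rewrite -lnM ?posrE; try lra.
    by rewrite ler_ln ?posrE; try lra; rewrite mulr_gt0; lra.
  have := @ln_ub R (1 - c * p).
  nra.
case: ltP => hq.
  have : ln (2 * p) + ln (1 + c * (1 - p)) <= ln (2 * q).
    have : 0 < 1 + c * (1 - p) by nra.
    move=> h; rewrite -lnM ?posrE; try lra.
    by rewrite ler_ln ?posrE; try lra; rewrite mulr_gt0; lra.
  have h1 : 0 <= c * (1 - p) by nra.
  have := @ln1D_ge R _ h1.
  suff : c / 2 <= 2 * (c * (1 - p)) / (2 + c * (1 - p)) by lra.
  rewrite ler_pdivlMr; last lra.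
  suff : 2 <= (4 - c) * (1 - p) by nra.
  (* Otherwise [p > (2 - c) / (4 - c)]. The map [p (1 + c (1 - p))] increases on [p < 1/2], and its
     value at that point is at least 1/2 exactly because [c <= 4/3]. *)
  rewrite leNgt; apply/negP => h.
  have : p * (1 + c * (1 - p)) < 1/2 by lra.
  nra.
pose y := c / 2.
have h0 : 4 * p * (1 - q) <= ((4 - y) / (4 + y)) ^+ 2.
  have y4 : 0 < 4 + y by rewrite /y; lra.
  rewrite expr_div_n ler_pdivlMr ?exprn_gt0//.
  have := @crossing_poly R y (1/2 - p).
  have -> : (1 - 4 * (1/2 - p) ^+ 2) * (1 - y + 2 * y * (1/2 - p)) =
      4 * p * ((1 - p) * (1 - c * p)).
    by rewrite /y; field.
  move=> h; apply: le_trans (h _ _); rewrite /y; try lra.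
  rewrite ler_wpM2r ?sqr_ge0// ler_wpM2l; lra.
have h1 : ln (2 * p) + ln (2 * (1 - q)) <= - y.
  rewrite -lnM ?posrE; try lra.
  have -> : 2 * p * (2 * (1 - q)) = 4 * p * (1 - q) by ring.
  apply: le_trans (_ : ln (((4 - y) / (4 + y)) ^+ 2) <= _).
    rewrite ler_ln ?posrE// ?exprn_gt0 ?divr_gt0 ?mulr_gt0//; rewrite /y; lra.
  (* With [1 + 2 y / (4 - y) = (4 + y) / (4 - y)], the logarithm of this ratio is at least [y / 2];
     the square doubles it. *)
  have z0 : 0 <= 2 * y / (4 - y) by rewrite divr_ge0// /y; lra.
  have := @ln1D_ge R _ z0.
  have -> : 2 * (2 * y / (4 - y)) / (2 + 2 * y / (4 - y)) = y / 2.
    field; rewrite /y; lra.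
  have -> : 1 + 2 * y / (4 - y) = ((4 - y) / (4 + y))^-1.
    field; rewrite /y; lra.
  rewrite lnV ?posrE ?divr_gt0//; [|rewrite /y; lra..].
  rewrite lnXn ?divr_gt0//; [|rewrite /y; lra..].
  lra.
move: h1; rewrite /y; lra.
Qed.

Definition skew_log (R : realType) (p : R) : R := 5 * ln p - 3 * ln (1 - p).

(** As [c (1 - p) <= 4/3], [ln p] gains at least [3/5 c (1 - p)], while [- ln (1 - p)] gains at
    least [c p]. The weights 5 and 3 make these add up to [3 c]. *)
Lemma skew_log_step (R : realType) (c p q : R) :
    0 < c <= 4 / 3 -> 0 < p < 1 -> q < 1 -> p + c * (p * (1 - p)) <= q ->
  skew_log R p + 3 * c <= skew_log R q.
Proof.
move=> /andP[c0 c1] /andP[p0 p1] q1 hpq.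
have pq : p <= q.
  by apply: le_trans hpq; rewrite lerDl !mulr_ge0 ?subr_ge0 ?ltW.
have cp : c * p < 1.
  have : c * p * (1 - p) < 1 - p by lra.
  by rewrite -[ltRHS]mul1r ltr_pM2r//; lra.
have h1 : 0 <= c * (1 - p) by nra.
rewrite /skew_log.
have : ln (1 - q) <= ln (1 - p) + ln (1 - c * p).
  rewrite -lnM ?posrE; try lra.
  by rewrite ler_ln ?posrE; try lra; rewrite mulr_gt0; lra.
have : ln p + ln (1 + c * (1 - p)) <= ln q.
  rewrite -lnM ?posrE; try lra.
  by rewrite ler_ln ?posrE; try lra; rewrite mulr_gt0; lra.
have := @ln_ub R (1 - c * p).
have := @ln1D_ge R _ h1.
suff : 3 / 5 * (c * (1 - p)) <= 2 * (c * (1 - p)) / (2 + c * (1 - p)) by lra.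
rewrite ler_pdivlMr; last lra.
nra.
Qed.

(** * Influences of monotone functions on the cube *)

Definition flip {n} (x : cube n) (k : 'I_n) : cube n := upd x k (~~ x k).

Lemma flipK n (k : 'I_n) : involutive (fun x : cube n => flip x k).
Proof.
by move=> x; apply/ffunP=> i; rewrite !ffunE eqxx; case: eqP => // ->; rewrite negbK.
Qed.

Lemma upd_flip n (x : cube n) k a : upd (flip x k) k a = upd x k a.
Proof. by apply/ffunP=> i; rewrite !ffunE; case: eqP. Qed.

Lemma upd_id n (x : cube n) k : upd x k (x k) = x.
Proof. by apply/ffunP=> i; rewrite ffunE; case: eqP => // ->. Qed.

Lemma hamming_flip n (x : cube n) k : hamming (flip x k) x = 1%N.
Proof.
rewrite /hamming -(cards1 k); apply: eq_card => i; rewrite !inE ffunE.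
by case: (eqVneq i k) => [->|_]; [case: (x k)|rewrite eqxx].
Qed.

Lemma set_to1U1 n (S : {set 'I_n}) k (x : cube n) :
  set_to1 (k |: S) x = set_to1 S (upd x k true).
Proof. by apply/ffunP=> i; rewrite !ffunE !inE; case: eqP; case: (i \in S). Qed.

Lemma monotone_set_to1 n (f : cube n -> bool) (S : {set 'I_n}) :
  monotone_fun f -> monotone_fun (fun x => f (set_to1 S x)).
Proof. by move=> hf x y xy; apply: hf => i; rewrite !ffunE; case: ifP. Qed.

Lemma ExE (R : realType) n (nu : cube n -> R) (g : cube n -> bool) :
  Ex nu (fun x => (g x)%:R) = Pr nu g.
Proof.
rewrite /Ex /Pr [RHS]big_mkcond/=; apply: eq_bigr => x _.
by case: (g x); rewrite ?mulr1 ?mulr0.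
Qed.

Section Prob.
Context {R : realType} {n : nat} {nu : cube n -> R}.
Hypothesis hnu : is_prob nu.

Lemma Pr_sub (A B : pred (cube n)) : {subset A <= B} -> Pr nu A <= Pr nu B.
Proof.
move=> AB; rewrite /Pr [leLHS]big_mkcond [leRHS]big_mkcond/=.
apply: ler_sum => x _; have := AB x; rewrite /in_mem /=.
by case: (A x) => [->//|_]; case: (B x) => //; case: hnu.
Qed.

Lemma VarE (g : cube n -> bool) :
  Var nu (fun x => (g x)%:R) = Pr nu g * (1 - Pr nu g).
Proof.
rewrite /Var ExE; set P := Pr nu g.
transitivity (\sum_x ((1 - 2 * P) * (nu x * (g x)%:R) + P ^+ 2 * nu x)).
  by apply: eq_bigr => x _; case: (g x) => /=; ring.
rewrite big_split/= -!mulr_sumr (proj2 hnu).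
by rewrite -[\sum_i _]/(Ex nu (fun x => (g x)%:R)) ExE -/P; ring.
Qed.

Lemma exists_light_point : (1 < n)%N -> exists x, nu x <= 1 / 4.
Proof.
move=> hn; apply/not_existsP => h.
have : 1 < 1 :> R; last by rewrite ltxx.
rewrite -[ltRHS](proj2 hnu).
have n4 : (4 <= #|{: cube n}|)%N.
  by rewrite card_ffun card_bool card_ord -[4%N]/(2 ^ 2)%N leq_exp2l.
have : \sum_(x : cube n) (1 / 4 : R) < \sum_x nu x.
  apply: ltr_sum => [|x _]; last by rewrite ltNge; apply/negP/h.
  by apply/hasP; exists [ffun=> true] => //; rewrite mem_index_enum.
rewrite sumr_const -mulr_natr; apply: le_lt_trans.
by have := n4; rewrite -(ler_nat R); lra.
Qed.

Context {b : R}.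
Hypotheses (hb : 1 <= b) (hratio : bounded_ratio b nu).

(** Division by 0 gives 0, so at a null point the ratio to a neighbour would be 0, below [1 / b];
    [0 < n] provides a neighbour. *)
Lemma mass_gt0 x : (0 < n)%N -> 0 < nu x.
Proof.
case: n nu hnu hratio x => // m mu [mu0 _] hr x _.
have /andP[h _] := hr _ _ (hamming_flip _ x ord0).
rewrite lt_def mu0 andbT; apply: contraTneq h => ->.
by rewrite invr0 mulr0 -ltNge invr_gt0 (lt_le_trans ltr01 hb).
Qed.

Lemma mass_flip x k : nu (flip x k) <= b * nu x.
Proof.
have n0 : (0 < n)%N by case: n k => // -[].
have /andP[_] := hratio _ _ (hamming_flip _ x k).
by rewrite ler_pdivrMr// mass_gt0.
Qed.

Lemma influence_le_gain (g : cube n -> bool) k : monotone_fun g ->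
  influence nu g k <= (1 + b) * (Pr nu (fun x => g (upd x k true)) - Pr nu g).
Proof.
move=> hg.
pose C x := g (upd x k true) && ~~ g (upd x k false).
have le_upd x a a' : (a <= a')%O -> g (upd x k a) -> g (upd x k a').
  move=> aa'; have : (g (upd x k a) <= g (upd x k a'))%O.
    by apply: hg => i; rewrite !ffunE; case: eqP.
  by case: (g _) => //; case: (g _).
pose D := Pr nu (fun x => C x && ~~ x k).
have hI : influence nu g k <= Pr nu C.
  apply: Pr_sub => x /existsP[a]; rewrite /in_mem/= /C.
  rewrite -[in g x](upd_id _ x k); case: a (x k) => -[]; rewrite ?eqxx// => h;
    have := le_upd x false true isT;
    by case: (g _) h => //; case: (g _) => //= _ /(_ isT).
have hC : Pr nu C <= (1 + b) * D.
  rewrite /Pr (bigID (fun x : cube n => ~~ x k))/= mulrDl mul1r lerD2l.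
  (* [C] ignores coordinate [k], so flipping [k] carries the half with value 1 onto the half with
     value -1, at a cost of a factor [b] in mass. *)
  rewrite (reindex_inj (inv_inj (flipK n k)))/= /D /Pr mulr_sumr.
  rewrite (eq_bigl (fun x => C x && ~~ x k)) => [|x].
    by apply: ler_sum => x _; exact: mass_flip.
  by rewrite /C !upd_flip ffunE eqxx negbK.
(* Setting coordinate [k] to 1 turns [g] from 0 to 1 at every point counted by [D]. *)
have hD : D <= Pr nu (fun x => g (upd x k true)) - Pr nu g.
  rewrite lerBrDr /D /Pr [X in _ + X]big_mkcond [X in X + _]big_mkcond.
  rewrite [leRHS]big_mkcond -big_split/=; apply: ler_sum => x _.
  have := hnu.1 x; rewrite /C.
  case: (boolP (x k)) => xk; rewrite ?andbF ?andbT.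
    by rewrite -{1}xk upd_id add0r.
  have -> : upd x k false = x by rewrite -(negbTE xk) upd_id.
  have := le_upd x false true isT.
  rewrite -{1}(negbTE xk) upd_id.
  by case: (g x) => [->//|_]; case: (g _); rewrite /= ?addr0 ?add0r.
apply: (le_trans hI); apply: (le_trans hC).
by rewrite ler_wpM2l ?addr_ge0 ?(le_trans ler01 hb).
Qed.

(** Changing coordinate [k] can alter the indicator of [x] only at [x] and at its flip. *)
Lemma influence_point x k : influence nu (pred1 x) k <= (1 + b) * nu x.
Proof.
apply: le_trans (_ : Pr nu (pred2 x (flip x k)) <= _).
  apply: Pr_sub => y /existsP[a]; rewrite /in_mem/=.
  case: (eqVneq y x) => //= yx; case: (eqVneq (upd y k a) x) => //= yx' _.
  apply/eqP.
  have yk : y k != x k.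
    apply: contraNneq yx => yk; rewrite -[y in y == _](upd_id _ y k) yk -yx'.
    by rewrite ffunE eqxx; apply/eqP/ffunP => i; rewrite !ffunE; case: eqP.
  apply/ffunP => i; rewrite -yx' !ffunE eqxx; case: eqP => // ->.
  by move: yk; rewrite -yx' ffunE eqxx; case: (y k) a {yx'} => -[].
have xk : flip x k != x.
  by apply/eqP => /ffunP /(_ k); rewrite ffunE eqxx; case: (x k).
rewrite /Pr (bigD1 x)/= ?eqxx// (bigD1 (flip x k))/= ?eqxx ?orbT//.
rewrite big1 => [|y]; last by case: (y == x) => //; case: (y == flip x k).
by rewrite addr0 mulrDl mul1r lerD2l mass_flip.
Qed.
End Prob.

(** * Greedy growth controlled by an abstract potential *)

Section Potential.
Context {R : realType} {V : R -> R} {k : R}.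
Hypothesis k0 : 0 < k.
Hypothesis hV : forall c p q : R, 0 < c <= 4 / 3 -> 0 < p < 1 -> q < 1 ->
  p + c * (p * (1 - p)) <= q -> V p + k * c <= V q.

(** Any increase from [p] to [q] is at least a logistic step for some small positive [c], so [hV]
    alone yields strict monotonicity. *)
Lemma potential_lt (p q : R) : 0 < p -> p < q -> q < 1 -> V p < V q.
Proof.
move=> p0 pq q1.
have pp : 0 < p * (1 - p) by rewrite mulr_gt0// subr_gt0 (lt_trans pq).
pose c := Num.min (4 / 3) ((q - p) / (p * (1 - p))).
have c0 : 0 < c by rewrite lt_min !divr_gt0 ?subr_gt0.
apply: lt_le_trans (_ : V p + k * c <= _); first by rewrite ltrDl mulr_gt0.
apply: hV => //; first by rewrite c0 ge_min lexx.
  by rewrite p0 (lt_trans pq).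
by rewrite -lerBrDl -ler_pdivlMr// ge_min lexx orbT.
Qed.

Lemma greedy n (m : {set 'I_n} -> R) (c eps : R) (t : nat) :
  0 < c <= 4 / 3 -> 0 < eps -> eps <= m set0 ->
  (forall S, 0 < m S < 1 ->
    exists i, m S + c * (m S * (1 - m S)) <= m (i |: S)) ->
  V (1 - eps) <= V eps + k * c * t%:R ->
  exists2 S : {set 'I_n}, (#|S| <= t)%N & 1 - eps <= m S.
Proof.
move=> hc eps0 hm hstep ht.
(* Invariant: either the target is reached, or the potential has gained [k c] per step. After [t]
   steps the latter would put it at [V (1 - eps)] or above with the mean still below [1 - eps]. *)
suff [//|[S [_ /andP[S1 S2] hS]]] :
    (exists2 S : {set 'I_n}, (#|S| <= t)%N & 1 - eps <= m S) \/
    exists S : {set 'I_n}, [/\ (#|S| <= t)%N, eps <= m S < 1 - eps &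
      V eps + k * c * t%:R <= V (m S)].
  have := le_trans ht hS.
  by rewrite leNgt potential_lt//; lra.
elim: t {ht} => [|t [[S St hS]|[S [St /andP[S1 S2] hS]]]].
- have [h|h] := leP (1 - eps) (m set0); first by left; exists set0; rewrite ?cards0.
  right; exists set0; rewrite cards0 hm h mulr0 addr0; split=> //.
  by move: hm; rewrite le_eqVlt => /predU1P[->//|e]; rewrite ltW// potential_lt//; lra.
- by left; exists S => //; rewrite (leq_trans St).
have [|i hi] := hstep S; first lra.
have iS : (#|i |: S| <= t.+1)%N by rewrite cardsU1; case: (i \in S); lia.
have [h|h] := leP (1 - eps) (m (i |: S)); first by left; exists (i |: S).
right; exists (i |: S); split=> //.
  rewrite h andbT (le_trans S1)// (le_trans _ hi)// lerDl !mulr_ge0//; lra.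
have := @hV c (m S) _ hc _ _ hi; rewrite -natr1; lra.
Qed.
End Potential.

(** * The growth rate supplied by the KKL theorem *)

Section Rate.
Context {R : realType} {b rho alpha : R} {Delta n : nat}.
Context {nu : cube n -> R} {e : rel 'I_n}.
Hypotheses (hb : 1 <= b) (halpha : 0 < alpha).
Hypothesis hKKL : KKL_constant b rho Delta alpha.
Hypotheses (hn : (1 < n)%N) (hnu : is_prob nu) (hratio : bounded_ratio b nu).
Hypotheses (hLS : log_sobolev rho nu) (he : simple_graph e).
Hypotheses (hDelta : max_degree e = Delta) (hMRF : markov_field e nu).

Definition rate (b alpha : R) (n : nat) : R :=
  alpha * ln n%:R / (n%:R * (1 + b)).

Let n0 : 0 < n%:R :> R.
Proof. by rewrite ltr0n ltnW. Qed.

Let b1 : 0 < 1 + b.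
Proof. by rewrite addr_gt0// (lt_le_trans ltr01). Qed.

Lemma rate_gt0 : 0 < rate b alpha n.
Proof. by rewrite /rate divr_gt0 ?mulr_gt0 ?ln_gt0 ?ltr1n. Qed.

Lemma KKL_rate (g : cube n -> bool) : exists k : 'I_n,
  (1 + b) * (rate b alpha n * (Pr nu g * (1 - Pr nu g))) <= influence nu g k.
Proof.
have [k hk] := hKKL n nu e g (ltnW hn) hnu hratio hLS he hDelta hMRF.
exists k; move: hk; rewrite (VarE hnu); apply: le_trans.
rewrite le_eqVlt; apply/orP; left; apply/eqP.
by rewrite /rate; field; rewrite !gt_eqF.
Qed.

(** For the indicator of a point of mass [p <= 1/4], the two bounds on the influence give
    [c p (1 - p) <= p], hence [c <= 1 / (1 - p) <= 4/3]. *)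
Lemma rate_le : rate b alpha n <= 4 / 3.
Proof.
have [x hx] := exists_light_point hnu hn.
have x0 := mass_gt0 hnu hb hratio x (ltnW hn).
have [k hk] := KKL_rate (pred1 x).
have := le_trans hk (influence_point hnu hb hratio x k).
rewrite ler_pM2l// /Pr big_pred1_eq mulrCA ger_pMr//.
have := rate_gt0; nra.
Qed.

Lemma rate_step (f : cube n -> bool) (S : {set 'I_n}) : monotone_fun f ->
  let m S := Ex nu (fun x => (f (set_to1 S x))%:R) in
  exists i, m S + rate b alpha n * (m S * (1 - m S)) <= m (i |: S).
Proof.
move=> hf /=; rewrite ExE; set P := Pr _ _.
have [k hk] := KKL_rate (fun x => f (set_to1 S x)).
exists k; have hg := monotone_set_to1 _ f S hf.
have := le_trans hk (influence_le_gain hnu hb hratio _ k hg).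
rewrite ler_pM2l// ExE -/P lerBrDl.
suff -> : Pr nu (fun x => f (set_to1 S (upd x k true))) =
  Pr nu (fun x => f (set_to1 (k |: S) x)) by [].
by apply: eq_bigl => x; rewrite set_to1U1.
Qed.

Lemma size_boundE eps :
  size_bound b alpha eps n = 4 * ln (1 / (2 * eps)) / rate b alpha n.
Proof.
have ln0 : 0 < ln n%:R :> R by rewrite ln_gt0 ?ltr1n.
by rewrite /size_bound /rate; field; rewrite !gt_eqF.
Qed.
End Rate.

(** * Choice of the number of steps *)

Lemma Ex_set_to1T (R : realType) n (nu : cube n -> R) (f : cube n -> bool) :
  is_prob nu -> monotone_fun f -> 0 < Ex nu (fun x => (f x)%:R) ->
  Ex nu (fun x => (f (set_to1 [set: 'I_n] x))%:R) = 1.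
Proof.
move=> hnu hf hE.
have [x fx] : exists x, f x.
  apply/not_existsP => h; move: hE; rewrite /Ex big1 ?ltxx// => x _.
  by case: (f x) (h x) => // h'; rewrite mulr0.
rewrite -[RHS](proj2 hnu); apply: eq_bigr => y _.
have : (f x <= f (set_to1 [set: 'I_n] y))%O.
  by apply: hf => i; rewrite !ffunE inE; case: (x i).
by rewrite fx; case: (f _) => // _ /=; rewrite mulr1.
Qed.

(* The bound on #|S| is n / log n = +oo for n = 1.  As #|S| is an integer, the
   bound as it is printed fails for eps close to 1/2 (a dictator function under
   the uniform measure, eps -> 1/2 from below) and it is negative for
   eps > 1/2; it is stated as it is printed for eps <= 1/32 and, for every eps,
   with its positive part rounded up. *)
Theorem corollary2p4 (R : realType) (b rho : R) (Delta : nat) (alpha : R)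
    (hb : 1 <= b) (hrho : 0 < rho <= 1)
    (halpha : 0 < alpha) (hKKL : KKL_constant b rho Delta alpha)
    (n : nat) (hn : (0 < n)%N)
    (nu : cube n -> R) (hnu : is_prob nu)
    (hratio : bounded_ratio b nu)
    (hLS : log_sobolev rho nu)
    (e : rel 'I_n) (he : simple_graph e) (hDelta : max_degree e = Delta)
    (hMRF : markov_field e nu)
    (eps : R) (heps : 0 < eps)
    (f : cube n -> bool) (hf : monotone_fun f)
    (hEf : eps <= Ex nu (fun x => (f x)%:R)) :
  exists S : {set 'I_n},
    1 - eps <= Ex nu (fun x => (f (set_to1 S x))%:R) /\
    ((1 < n)%N ->
      (eps <= 1 / 32 -> #|S|%:R <= size_bound b alpha eps n) /\
      #|S|%:Z <= Num.ceil (Num.max 0 (size_bound b alpha eps n))).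
Proof.
pose m (S : {set 'I_n}) := Ex nu (fun x => (f (set_to1 S x))%:R).
have m0 : eps <= m set0.
  rewrite /m (_ : (fun x => _) = fun x => (f x)%:R)//.
  by apply/funext => x; congr (f _)%:R; apply/ffunP=> i; rewrite ffunE inE.
have [n1|n1] := leqP n 1.
  exists [set: 'I_n]; split=> //.
  rewrite Ex_set_to1T//; first lra.
  exact: lt_le_trans hEf.
(* Here [1 - eps <= eps], so the empty set suffices. *)
have [half|half] := leP (1 / 2) eps.
  exists set0; split=> [|_]; first by move: m0; rewrite /m; lra.
  rewrite cards0; split; first lra.
  by rewrite -(ler_int R) (le_trans _ (ceil_ge _))// le_max lexx.
have c0 := rate_gt0 hb halpha n1.
have c1 := rate_le hb halpha hKKL n1 hnu hratio hLS he hDelta hMRF.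
have hstep S := rate_step hb hKKL n1 hnu hratio hLS he hDelta hMRF f S hf.
rewrite size_boundE//.
move: c0 c1 hstep; set c := rate _ _ _ => c0 c1 hstep.
have hc : 0 < c <= 4 / 3 by rewrite c0.
set L := ln _; set B := 4 * L / c.
have BE : c * B = 4 * L by rewrite /B mulrC divfK// gt_eqF.
have LE : L = - ln (2 * eps) by rewrite /L div1r lnV// posrE; lra.
have L0 : 0 < L by rewrite /L ln_gt0// ltr_pdivlMr; lra.
have B0 : 0 < B by rewrite divr_gt0// mulr_gt0.
have [small|large] := leP eps (1 / 32).
- have [S hS mS] : exists2 S : {set 'I_n}, (#|S| <= Num.truncn B)%N & 1 - eps <= m S.
    apply: (@greedy R (skew_log R) 3 _ _ n m c) => //.
    + exact: skew_log_step.
    + move=> S _; exact: hstep.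
    (* The potential must rise by at most [8 (L + ln 2)], and [Num.truncn B] steps bring more than
       [12 L - 3 c >= 12 L - 4]. This is enough since [eps <= 1/32] gives [L >= 4 ln 2], and
       [ln 2 >= 2/3]. *)
    have hT : B < (Num.truncn B)%:R + 1 by rewrite natr1 -truncn_le_nat.
    have h1 : 4 * L < c * (Num.truncn B)%:R + c.
      by move: hT; rewrite -(ltr_pM2l c0) BE mulrDr mulr1.
    have l2 := ln_2_ge R.
    have hL : 4 * ln 2 <= L.
      rewrite LE -(_ : ln (2 ^+ 4) = 4 * ln 2); last by rewrite lnXn// mulr_natl.
      rewrite -lnV ?posrE; last lra.
      have eps2 : 0 < 2 * eps by lra.
      rewrite ler_ln ?posrE ?exprn_gt0 ?invr_gt0// -[leRHS]div1r ler_pdivlMr//.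
      rewrite (_ : 2 ^+ 4 = 16 :> R); [lra | ring].
    have e1 : ln (1 - eps) <= 0 by rewrite ln_le0//; lra.
    have e2 : ln eps = - L - ln 2 by rewrite LE lnM ?posrE//; lra.
    rewrite /skew_log subKr; lra.
  have SB : #|S|%:R <= B.
    by apply: le_trans (_ : (Num.truncn B)%:R <= _); rewrite ?ler_nat ?truncn_le ?ltW.
  exists S; split=> // _; split=> //.
  by rewrite -(ler_int R) (le_trans SB)// (le_trans _ (ceil_ge _))// le_max lexx orbT.
have [S hS mS] : exists2 S : {set 'I_n}, (#|S| <= `|Num.ceil B|)%N & 1 - eps <= m S.
  apply: (@greedy R (fold_log R) (1/2) _ _ n m c) => //.
  + lra.
  + by move=> c' p q h1 h2 h3 h4; have := fold_log_step _ _ _ _ h1 h2 h3 h4; lra.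
  + move=> S _; exact: hstep.
  have hT : B <= `|Num.ceil B|%N%:R.
    by rewrite pmulrn gez0_abs ?ceil_ge// ceil_ge0; lra.
  have h1 : 4 * L <= c * `|Num.ceil B|%N%:R by rewrite -BE ler_pM2l.
  (* The potential goes from [- L] to [L], and [2 L] is exactly [c / 2 * B]. *)
  rewrite /fold_log half ifF; last by apply/negbTE; rewrite -leNgt; lra.
  by rewrite subKr; lra.
exists S; split=> // _; split; first lra.
rewrite (max_idPr (ltW B0)) -(@gez0_abs (Num.ceil B)) ?lez_nat// ceil_ge0; lra.
Qed.
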